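(* For all real numbers $\alpha, \beta \in (0,1]$ there exists a positive integer $k_0 = k_0(\alpha,\beta)$ such that the following holds. Let $(X,\mu,T)$ and $(Y,\nu,S)$ be measure-preserving systems, and let $A \subset X$, $B \subset Y$ be measurable sets with $\mu(A) = \alpha$ and $\nu(B) = \beta$. Then there exists an integer $k$ with $1 \le k \le k_0$ such that $k\,\mathbb{Z} \subset R(A)\cdot R(B)$.
   Context: A measure-preserving system is a triple $(X,\mu,T)$ where $X$ is a compact metric space, $\mu$ is a probability measure on the Borel $\sigma$-algebra of $X$, and $T: X \to X$ is a bi-measurable map (an invertible map such that $T$ and $T^{-1}$ are both measurable) which preserves $\mu$. For a measurable set $A \subset X$ with $\mu(A)>0$, the set of return times of $A$ is $R(A) = \{ n \in \mathbb{Z} \mid \mu(A \cap T^n A) > 0\}$; similarly $R(B) = \{ n \in \mathbb{Z} \mid \nu(B \cap S^n B) > 0\}$ for $B \subset Y$. For $P, Q \subset \mathbb{Z}$, $P \cdot Q = \{pq \mid p \in P, q \in Q\}$, and $k\,\mathbb{Z} = \{kn \mid n \in \mathbb{Z}\}$. *)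

(* Defs.v *)
From HB Require Import structures.
From mathcomp Require Import all_boot all_order all_algebra.
From mathcomp Require Import all_classical all_reals all_analysis.

Set Implicit Arguments.
Unset Strict Implicit.
Unset Printing Implicit Defensive.

Import Order.TTheory GRing.Theory Num.Theory.

Local Open Scope classical_set_scope.
Local Open Scope ring_scope.

(* [Measurable] types are pointed, hence nonempty; this excludes nothing, since
   the spaces below carry a probability measure. *)
HB.mixin Record isCompactBorel (R : realType) (d : measure_display) X
    & Metric R X & Measurable d X := {
  compactT : compact [set: X] ;
  measurable_borel : @measurable d X = <<s @open X >>
}.

#[short(type="compactMetricBorelType")]
HB.structure Definition CompactMetricBorel (R : realType) (d : measure_display) :=
  { X of Metric R X & Measurable d X & isCompactBorel R d X }.

Record mpsystem (R : realType) (d : measure_display)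
    (X : compactMetricBorelType R d) := MPSystem {
  mps_measure : probability X R ;
  mps_map : X -> X ;
  mps_inv : X -> X ;
  mps_mapK : cancel mps_map mps_inv ;
  mps_invK : cancel mps_inv mps_map ;
  measurable_mps_map : measurable_fun [set: X] mps_map ;
  measurable_mps_inv : measurable_fun [set: X] mps_inv ;
  mps_preserving : forall A : set X, measurable A ->
    pushforward mps_measure mps_map A = mps_measure A
}.

Section ReturnTimes.
Context (R : realType) (d : measure_display) (X : compactMetricBorelType R d).
Variable s : mpsystem X.

(* [Negz m] is the integer [- (m.+1)]. *)
Definition mps_iter (n : int) : X -> X :=
  match n with
  | Posz m => iter m (mps_map s)
  | Negz m => iter m.+1 (mps_inv s)
  end.

Definition return_times (A : set X) : set int :=
  [set n | (0 < mps_measure s (A `&` mps_iter n @` A))%E].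

End ReturnTimes.

Definition prod_set (P Q : set int) : set int :=
  [set p * q | p in P & q in Q].

Definition multiples (k : int) : set int := [set k * n | n in [set: int]].

(* Main.v *)
Require Import Defs.
From HB Require Import structures.
From mathcomp Require Import all_boot all_order all_algebra.
From mathcomp Require Import all_classical all_reals all_analysis.
From mathcomp Require Import ring.

Import Order.TTheory GRing.Theory Num.Theory.

Local Open Scope classical_set_scope.
Local Open Scope ring_scope.

(** The proof combines two applications of the pigeonhole form of Poincaré
    recurrence: if [M * mu A > 1], then among any [M] translates of [A] by
    powers of [T] two meet in positive measure, so the return times of [A]
    contain a difference of any [M] integers; they form a [delta_star M] set.

    Let [M * alpha > 1].  Given [n], the translates of [A] by [T ^ (|n| * a)],
    for [a < M], yield [0 < d < M] with [|n| * d] a return time of [A], and so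
    is [n * d] because [- n] returns whenever [n] does.  The
    number [d] depends on [n], but it belongs to a finite set that does not.
    Hence it suffices to find one bounded [k], divisible by every such [d], for
    which all the quotients [k / d] are return times of [B]: then
    [k * n = (n * d) * (k / d)].

    With [k = M`! * t], this asks for a single [t] such that [M`! / d * t] is a
    return time of [B] for every [0 < d < M].  For each fixed [d], these [t]
    form a [delta_star] set ([delta_star_dilate]).  By Ramsey's theorem
    ([ramsey_pairwise]) a finite intersection of [delta_star] sets is again
    one ([delta_star_all]), with a bound depending only on [M] and [beta].
    A [delta_star N] set contains a positive integer below [N], and
    this bounds [t]. *)

(** * Ramsey's theorem and difference-recurrent sets *)

(** Neighbours and non-neighbours of the head [x] split the tail, so one of the
    two parts has at least half of it; [x] extends a clique found in the
    former or an independent set found in the latter. *)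
Lemma ramsey_pairwise {T : eqType} (e : rel T) (m n : nat) (s : seq T) :
  (2 ^ (m + n) <= size s)%N ->
  (exists u, [/\ subseq u s, size u = m & pairwise e u]) \/
  (exists u, [/\ subseq u s, size u = n & pairwise (fun x y => ~~ e x y) u]).
Proof.
move: {2}(m + n)%N (erefl (m + n)%N) => k.
elim: k m n s => [|k IHk] m n s mnk.
  move: m n mnk => [|//] [|//] _ _.
  by left; exists [::]; rewrite sub0seq.
case: m mnk => [|m] mnk; first by left; exists [::]; rewrite sub0seq.
case: n mnk => [|n] mnk; first by right; exists [::]; rewrite sub0seq.
case: s => [|x s]; first by rewrite leqn0 expn_eq0.
rewrite mnk expnS mul2n [size _]/=.
rewrite -(count_predC (e x) s) -!size_filter => szs.
have : (2 ^ k <= size [seq y <- s | e x y])%N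
    || (2 ^ k <= size [seq y <- s | predC (e x) y])%N.
  apply: contraLR szs; rewrite negb_or -!ltnNge => /andP[lt1 lt2].
  by rewrite -addnn -addnS -addSn leq_add.
case/orP => sz.
- have mnk' : (m + n.+1)%N = k by move: mnk; rewrite addSn => -[].
  move: sz; rewrite -{1}mnk' => /(IHk _ _ _ mnk')[[u [us szu pu]]|].
    left; exists (x :: u); split.
    - by rewrite /= eqxx (subseq_trans us)// filter_subseq.
    - by rewrite /= szu.
    - rewrite /= pu andbT; apply/allP => y /(mem_subseq us).
      by rewrite mem_filter => /andP[].
  move=> [u [us szu pu]]; right; exists u; split => //.
  exact: subseq_trans us (subseq_trans (filter_subseq _ _) (subseq_cons _ _)).
- have mnk' : (m.+1 + n)%N = k by move: mnk; rewrite addnS => -[].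
  move: sz; rewrite -{1}mnk' => /(IHk _ _ _ mnk')[[u [us szu pu]]|].
    left; exists u; split => //.
    exact: subseq_trans us (subseq_trans (filter_subseq _ _) (subseq_cons _ _)).
  move=> [u [us szu pu]]; right; exists (x :: u); split.
  - by rewrite /= eqxx (subseq_trans us)// filter_subseq.
  - by rewrite /= szu.
  - rewrite /= pu andbT; apply/allP => y /(mem_subseq us).
    by rewrite mem_filter => /andP[].
Qed.

(** These are the usual Delta-star sets, except that sequences are only required
    to be nondecreasing: allowing repetitions makes the notion stable under
    dilation by [0]. *)
Definition delta_star (M : nat) (P : pred nat) : Prop :=
  forall s : seq nat, pairwise leq s -> (M <= size s)%N ->
    ~~ pairwise (fun a b => ~~ P (b - a)%N) s.

Lemma delta_star_dilate (M c : nat) (P : pred nat) :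
  delta_star M P -> delta_star M (fun t => P (c * t)%N).
Proof.
move=> dP s les szs.
have := dP [seq (c * a)%N | a <- s]; rewrite size_map !pairwise_map.
have -> : pairwise (relpre (muln c) leq) s.
  by apply: sub_pairwise les => a b /= ab; rewrite leq_mul2l ab orbT.
move=> /(_ isT szs).
rewrite (_ : pairwise _ _ = pairwise (fun a b => ~~ P (c * (b - a))%N) s)//.
by apply: eq_pairwise => a b /=; rewrite mulnBr.
Qed.

(** If no difference of a long sequence satisfied both predicates, a large
    subsequence would have all its differences in [P] or none of them; the
    former would have none in [Q]. *)
Lemma delta_starI (M N : nat) (P Q : pred nat) :
  delta_star M P -> delta_star N Q -> delta_star (2 ^ (N + M)) (predI P Q).
Proof.
move=> dP dQ s les szs; apply/negP => noPQ.
case: (ramsey_pairwise (fun a b => P (b - a)%N) N M s szs) => -[u [us szu pu]].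
- have := dQ u; rewrite szu leqnn => /(_ (subseq_pairwise us les) isT)/negP.
  apply.
  have := conj pu (subseq_pairwise us noPQ) => /andP; rewrite -pairwise_relI.
  by apply: sub_pairwise => a b /= /andP[->].
- have := dP u; rewrite szu leqnn => /(_ (subseq_pairwise us les) isT)/negP.
  by apply.
Qed.

Lemma delta_star_all (M r : nat) : exists N : nat,
  forall Ps : seq (pred nat), size Ps = r ->
    (forall i, (i < r)%N -> delta_star M (nth xpredT Ps i)) ->
    delta_star N (fun t => all (fun P : pred nat => P t) Ps).
Proof.
elim: r => [|r [N IH]].
  exists 2 => Ps /size0nil -> _ s _.
  by case: s => [|a [|b s]].
exists (2 ^ (N + M))%N => -[//|P Ps] /= [szPs] dPs.
apply: delta_starI; first exact: (dPs 0).
by apply: IH => // i ir; exact: (dPs i.+1).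
Qed.

(** The differences of [0, 1, ..., N - 1] are the positive integers below [N]. *)
Lemma delta_star_exists (N : nat) (P : pred nat) :
  delta_star N P -> exists2 t, (0 < t < N)%N & P t.
Proof.
move=> dP.
have ltn_iota : pairwise ltn (iota 0 N).
  by rewrite -(sorted_pairwise ltn_trans) iota_ltn_sorted.
have les : pairwise leq (iota 0 N).
  by apply: sub_pairwise ltn_iota => a b /ltnW.
have := dP _ les; rewrite size_iota => /(_ (leqnn N)) noP.
apply: contrapT => nex; move/negP: noP; apply.
apply/(pairwiseP 0%N) => i j; rewrite !inE size_iota => iN jN ij.
rewrite !nth_iota// !add0n; apply/negP => Pji; apply: nex; exists (j - i)%N => //.
by rewrite subn_gt0 ij (leq_ltn_trans (leq_subr _ _)).
Qed.

(** * Measures of almost disjoint sets *)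

Lemma measure_bigsetU_ae_disjoint {d : measure_display} {T : measurableType d}
    {R : realType} (mu : {measure set T -> \bar R}) (I : Type) (F : I -> set T)
    (s : seq I) :
  (forall i, measurable (F i)) ->
  pairwise (fun i j => mu (F i `&` F j) == 0%E) s ->
  mu (\big[setU/set0]_(i <- s) F i) = (\sum_(i <- s) mu (F i))%E.
Proof.
move=> mF; elim: s => [_|a s IH /= /andP[as0 /IH IHs]].
  by rewrite !big_nil measure0.
rewrite !big_cons -IHs.
set U := \big[setU/set0]_(i <- s) F i.
have mU : measurable U by apply: bigsetU_measurable => i _.
have FU0 : mu (F a `&` U) = 0%E.
  rewrite /U; elim: s as0 {U mU IH IHs} => [|b s IH] /=.
    by rewrite big_nil setI0 measure0.
  move=> /andP[/eqP ab0 /IH as0]; rewrite big_cons setIUr measureU0//.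
  - exact: measurableI.
  - by apply: measurableI => //; apply: bigsetU_measurable => i _.
have -> : F a `|` U = F a `\` U `|` U by rewrite setUDl setDv setD0.
have mFU : measurable (F a `\` U) by exact: measurableD.
rewrite measureU ?setDKI//.
congr (_ + _)%E; apply/esym; rewrite -[RHS]adde0 -FU0.
exact: (measureDI mu (mF a) mU).
Qed.

(** * Return times *)

Section Returns.
Context {R : realType} {d : measure_display} {X : compactMetricBorelType R d}.
Variable s : mpsystem X.

Lemma image_mps_map (E : set X) : mps_map s @` E = mps_inv s @^-1` E.
Proof.
apply/seteqP; split => [_ [x Ex <-] /=|x /= Ex]; first by rewrite mps_mapK.
by exists (mps_inv s x); rewrite ?mps_invK.
Qed.

Lemma measurable_image_mps_map (E : set X) :
  measurable E -> measurable (mps_map s @` E).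
Proof.
move=> mE; rewrite image_mps_map -[_ @^-1` _]setTI.
exact: measurable_mps_inv.
Qed.

Lemma measure_image_mps_map (E : set X) :
  measurable E -> mps_measure s (mps_map s @` E) = mps_measure s E.
Proof.
move=> mE; rewrite -mps_preserving; last exact: measurable_image_mps_map.
rewrite /pushforward image_mps_map; congr (mps_measure s _).
by apply/seteqP; split => x /=; rewrite mps_mapK.
Qed.

Lemma image_iterS (f : X -> X) (n : nat) (E : set X) :
  iter n.+1 f @` E = f @` (iter n f @` E).
Proof. by rewrite image_comp. Qed.

Lemma measurable_image_iter (n : nat) (E : set X) :
  measurable E -> measurable (iter n (mps_map s) @` E).
Proof.
move=> mE; elim: n => [|n IH]; first by rewrite image_id.
by rewrite image_iterS; exact: measurable_image_mps_map.
Qed.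

Lemma measure_image_iter (n : nat) (E : set X) :
  measurable E -> mps_measure s (iter n (mps_map s) @` E) = mps_measure s E.
Proof.
move=> mE; elim: n => [|n IH]; first by rewrite image_id.
rewrite image_iterS measure_image_mps_map//; exact: measurable_image_iter.
Qed.

Lemma measure_image_iterI (a b : nat) (A : set X) :
  measurable A -> (a <= b)%N ->
  mps_measure s (iter a (mps_map s) @` A `&` iter b (mps_map s) @` A) =
  mps_measure s (A `&` iter (b - a) (mps_map s) @` A).
Proof.
move=> mA; elim: a b => [|a IH] [|b]// ab; first by rewrite !image_id.
  by rewrite image_id subn0.
rewrite !image_iterS !image_mps_map -preimage_setI -image_mps_map.
rewrite measure_image_mps_map; first by rewrite IH.
by apply: measurableI; exact: measurable_image_iter.
Qed.

(** The translates of [A] by [T ^ a] all have measure [alpha]; if they were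
    pairwise almost disjoint, their union would have measure
    at least [M * alpha > 1]. *)
Lemma delta_star_return_times (A : set X) (alpha : R) (M : nat) :
  measurable A -> mps_measure s A = alpha%:E -> 1 < M%:R * alpha ->
  delta_star M (fun m => m%:Z \in return_times s A).
Proof.
move=> mA Aalpha Malpha u leu szu; apply/negP => nou.
have alpha_ge0 : 0 <= alpha by rewrite -lee_fin -Aalpha measure_ge0.
have mF a : measurable (iter a (mps_map s) @` A) by exact: measurable_image_iter.
have : mps_measure s (\big[setU/set0]_(a <- u) (iter a (mps_map s) @` A)) =
    ((size u)%:R * alpha)%:E.
  rewrite measure_bigsetU_ae_disjoint//.
    rewrite (eq_bigr (fun=> alpha%:E)) => [|a _]; last first.
      by rewrite -Aalpha; exact: measure_image_iter.
    by rewrite sumEFin big_const_seq count_predT iter_addr_0 mulr_natl.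
  have := conj leu nou => /andP; rewrite -pairwise_relI.
  apply: sub_pairwise => a b /= /andP[ab]; rewrite notin_setE /= => /negP.
  rewrite -leNgt measure_le0 => /eqP ab0; apply/eqP.
  by rewrite -ab0; exact: measure_image_iterI.
move=> measU.
have : (((size u)%:R * alpha)%:E <= 1)%E.
  by rewrite -measU probability_le1//; apply: bigsetU_measurable.
rewrite lee_fin leNgt (lt_le_trans Malpha)//.
by rewrite ler_wpM2r// ler_nat.
Qed.

Lemma measure_preimage_iter (n : nat) (E : set X) :
  measurable E -> mps_measure s (iter n (mps_map s) @^-1` E) = mps_measure s E.
Proof.
elim: n E => [//|n IH] E mE.
have mTE : measurable (mps_map s @^-1` E).
  by rewrite -[_ @^-1` _]setTI; exact: measurable_mps_map.
by rewrite -(mps_preserving s mE); exact: IH mTE.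
Qed.

(** [A] and its translate by [T ^ (- m)] are the inverse images under [T ^ m] of
    the translate of [A] by [T ^ m] and of [A]. *)
Lemma return_times_opp (A : set X) (m : nat) :
  measurable A -> return_times s A m%:Z -> return_times s A (- m%:Z).
Proof.
move=> mA; case: m => [//|m]; rewrite -NegzE.
suff e : mps_measure s (A `&` iter m.+1 (mps_inv s) @` A) =
    mps_measure s (A `&` iter m.+1 (mps_map s) @` A).
  by move=> Am; rewrite /return_times/= -[X in (_ < X)%E]/(mps_measure s
    (A `&` iter m.+1 (mps_inv s) @` A)) e.
have iter_can (f g : X -> X) k : cancel f g -> cancel (iter k f) (iter k g).
  by move=> fK; elim: k => [//|k IH] x; rewrite iterSr /= fK IH.
have mapK := iter_can _ _ m.+1 (mps_mapK s).
have invK := iter_can _ _ m.+1 (mps_invK s).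
move: (m.+1) mapK invK => {iter_can}m mapK invK.
rewrite -[RHS](measure_preimage_iter m); last first.
  by apply: measurableI => //; exact: measurable_image_iter.
congr (mps_measure s _); apply/seteqP; split => x /=.
- by move=> [Ax [y Ay yx]]; split; [rewrite -yx invK | exists x].
- move=> [Amy [y Ay /(can_inj mapK) yx]]; rewrite -yx in Amy *; split => //.
  by exists (iter m (mps_map s) y); rewrite ?mapK.
Qed.
End Returns.

(** * Products of return times *)

Lemma ex_natmul_gt1 {R : realType} (x : R) :
  0 < x -> exists M : nat, 1 < M%:R * x.
Proof.
move=> x0; exists (Num.trunc x^-1).+1.
by rewrite -ltr_pdivrMr// mul1r truncnS_gt.
Qed.

Theorem theorem1p1 (R : realType) (alpha beta : R)
    (alpha_gt0 : 0 < alpha) (alpha_le1 : alpha <= 1)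
    (beta_gt0 : 0 < beta) (beta_le1 : beta <= 1) :
  exists k0 : int, 0 < k0 /\
    forall (dX dY : measure_display)
      (X : compactMetricBorelType R dX) (Y : compactMetricBorelType R dY)
      (sX : mpsystem X) (sY : mpsystem Y) (A : set X) (B : set Y),
      measurable A -> measurable B ->
      mps_measure sX A = alpha%:E -> mps_measure sY B = beta%:E ->
      exists k : int, 1 <= k <= k0 /\
        multiples k `<=` prod_set (return_times sX A) (return_times sY B).
Proof.
have [M Malpha] := ex_natmul_gt1 alpha alpha_gt0.
have [L Lbeta] := ex_natmul_gt1 beta beta_gt0.
have [N starN] := delta_star_all L M.
(* [N.+1] in place of [N] makes the bound positive by construction. *)
exists (M`! * N.+1)%:Z; split; first by rewrite ltz_nat muln_gt0 fact_gt0.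
move=> dX dY X Y sX sY A B mA mB muA muB.
have starA := delta_star_return_times sX A alpha M mA muA Malpha.
have starB := delta_star_return_times sY B beta L mB muB Lbeta.
(* The quotient [M`! %/ d] is exact for [0 < d < M], and [0] for [d = 0]. *)
pose quotient_returns d : pred nat :=
  fun t => (M`! %/ d * t)%N%:Z \in return_times sY B.
have [t /andP[t_gt0 tN] /allP retB] := delta_star_exists _ _
  (starN (mkseq quotient_returns M) (size_mkseq _ _)
    (fun d dM => eq_ind_r (delta_star L)
       (delta_star_dilate L (M`! %/ d) _ starB) (nth_mkseq _ _ dM))).
exists (M`! * t)%:Z; split.
  apply/andP; split; last by rewrite lez_nat leq_mul// leqW// ltnW.
  by rewrite -gtz0_ge1 ltz_nat muln_gt0 fact_gt0.
move=> _ [n _ <-].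
have [d /andP[d_gt0 dM]] := delta_star_exists _ _
  (delta_star_dilate M `|n|%N _ starA).
rewrite in_setE => retA.
exists (n * d%:Z).
  case: (intP n) retA => [|m|m]; rewrite ?mul0r ?absz0 ?mul0n// => retA.
  by rewrite mulNr; apply: return_times_opp => //; rewrite abszN in retA.
exists (M`! %/ d * t)%N%:Z.
  rewrite -in_setE; apply: (retB (quotient_returns d)).
  by apply: map_f; rewrite mem_iota.
have dvd_dM : (d %| M`!)%N by rewrite dvdn_fact// d_gt0 ltnW.
by rewrite -{2}(divnK dvd_dM) !PoszM; ring.
Qed.
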